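(* Let $n\ge 1$ be an integer, let $\underline{k}=(k_1,\dots,k_n)$ be an $n$-tuple of integers with $k_i>1$ for every $i$, and let $\underline{h}=(h_1,\dots,h_n)$ be an $n$-tuple of integers with $0<h_i<k_i$ for every $i$. Then the degree class group $\Delta_{CS^n(\underline k;\underline h)}$ of the graph $CS^n(\underline k;\underline h)$ is cyclic.
   Context: Graphs are finite, and multiple edges are allowed. Degree class group of a graph: let $\Gamma$ be a connected loopless graph with vertices $v_1,\dots,v_\gamma$. For $i\neq j$ let $k_{ij}$ be the number of edges connecting $v_i$ and $v_j$, and let $k_{ii}=-(\text{degree of }v_i)$. Set $\underline c_i=(k_{i1},\dots,k_{i\gamma})\in\mathbb Z^\gamma$, $Z=\{\underline z\in\mathbb Z^\gamma:\ \sum_i z_i=0\}$, and let $\Lambda_\Gamma\subseteq Z$ be the subgroup generated by $\underline c_1,\dots,\underline c_\gamma$. The degree class group (DCG) of $\Gamma$ is the finite abelian group $\Delta_\Gamma=Z/\Lambda_\Gamma$. The graphs $CS^n(\underline k;\underline h)$: for each $j$, let $\mathcal C_{k_j}$ be a cycle with $k_j$ vertices $v^j_1,\dots,v^j_{k_j}$ in cyclic order and $k_j$ edges $v^j_1v^j_2,\ v^j_2v^j_3,\dots,v^j_{k_j-1}v^j_{k_j},\ v^j_{k_j}v^j_1$ (for $k_j=2$ these are two distinct parallel edges $v^j_1v^j_2$ and $v^j_2v^j_1$). The graph is defined inductively. $CS^1(k_1;h_1)=\mathcal C_{k_1}$. For $n\ge 2$, $CS^n(\underline k;\underline h)$ is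 obtained from the disjoint union of $CS^{n-1}((k_1,\dots,k_{n-1});(h_1,\dots,h_{n-1}))$ and $\mathcal C_{k_n}$ by identifying the vertex $v^n_1$ with $v^{n-1}_{h_{n-1}}$, the vertex $v^n_{k_n}$ with $v^{n-1}_{h_{n-1}+1}$, and the edge $v^n_{k_n}v^n_1$ with the edge $v^{n-1}_{h_{n-1}}v^{n-1}_{h_{n-1}+1}$ of the cycle $\mathcal C_{k_{n-1}}$. So the graph is a chain of polygons in which each polygon and the following one are glued along exactly one edge. *)

(* Defs.v *)
From HB Require Import structures.
From mathcomp Require Import all_boot all_order all_algebra.
From mathcomp Require Import boolp.

Set Implicit Arguments.
Unset Strict Implicit.
Unset Printing Implicit Defensive.

Import Order.TTheory GRing.Theory Num.Theory.
Local Open Scope ring_scope.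
Local Open Scope quotient_scope.

(* The order of the two components of [ends e] carries no meaning: every notion
   below is invariant under swapping them. *)
Record multigraph := Multigraph {
  vertex : finType;
  edge : finType;
  ends : edge -> vertex * vertex }.

Definition joins (G : multigraph) (e : edge G) (u v : vertex G) : bool :=
  (ends e == (u, v)) || (ends e == (v, u)).

Definition multiplicity (G : multigraph) (u v : vertex G) : nat :=
  #|[set e : edge G | joins e u v]|.

(* A loop contributes 2. *)
Definition degree (G : multigraph) (v : vertex G) : nat :=
  (#|[set e : edge G | (ends e).1 == v]| +
   #|[set e : edge G | (ends e).2 == v]|)%N.

Definition loopless (G : multigraph) : Prop :=
  forall e : edge G, (ends e).1 != (ends e).2.

Definition degree_row (G : multigraph) (u : vertex G) : {ffun vertex G -> int} :=
  [ffun v => if v == u then - (degree u)%:Z else (multiplicity u v)%:Z].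

Definition zero_sum (V : finType) : pred {ffun V -> int} :=
  fun z => \sum_v z v == 0.

Fact zero_sum_zmod_closed (V : finType) : zmod_closed (@zero_sum V).
Proof.
split=> [|x y]; rewrite !unfold_in.
  by rewrite big1 // => v _; rewrite ffunE.
move=> /eqP x0 /eqP y0; under eq_bigr => v _ do rewrite !ffunE.
by rewrite big_split /= sumrN x0 y0 oppr0 addr0.
Qed.

HB.instance Definition _ (V : finType) :=
  GRing.isZmodClosed.Build {ffun V -> int} (@zero_sum V)
    (zero_sum_zmod_closed V).

Record zero_sum_group (V : finType) := ZeroSum {
  zs_val : {ffun V -> int};
  _ : zs_val \in @zero_sum V }.

HB.instance Definition _ (V : finType) := [isSub for @zs_val V].
HB.instance Definition _ (V : finType) :=
  [Choice of zero_sum_group V by <:].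
HB.instance Definition _ (V : finType) :=
  [SubChoice_isSubZmodule of zero_sum_group V by <:].

Lemma degree_row_zero_sum (G : multigraph) (u : vertex G) :
  loopless G -> degree_row u \in @zero_sum (vertex G).
Proof.
move=> loopG; rewrite unfold_in (bigD1 u) //= ffunE eqxx.
under eq_bigr => v vu do rewrite ffunE (negPf vu).
rewrite addrC subr_eq0 -(big_morph Posz PoszD (erefl _)) eqz_nat.
have mE v : v != u -> multiplicity u v =
    (\sum_(e : edge G) (ends e == (u, v)) + \sum_(e : edge G) (ends e == (v, u)))%N.
  move=> vu; rewrite -big_split /multiplicity -sum1dep_card big_mkcond /=.
  apply: eq_bigr => e _; rewrite /joins; case: eqP => [->|_]; last by case: eqP.
  by rewrite xpair_eqE [u == v]eq_sym (negPf vu).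
apply/eqP; under eq_bigr => v vu do rewrite mE //.
rewrite big_split /= exchange_big /= [X in (_ + X)%N]exchange_big /=.
rewrite /degree -!sum1dep_card; congr addn;
  rewrite [RHS]big_mkcond /=; apply: eq_bigr => e _;
  have := loopG e; case: (ends e) => a b /= ab.
- have [au|au] := eqVneq a u; last first.
    by rewrite big1 // => v _; rewrite xpair_eqE (negPf au).
  rewrite (bigD1 b) ?[b == u]eq_sym -?au //= eqxx big1 // => v /andP[_ vb].
  by rewrite xpair_eqE [b == v]eq_sym (negPf vb) andbF.
- have [bu|bu] := eqVneq b u; last first.
    by rewrite big1 // => v _; rewrite xpair_eqE (negPf bu) andbF.
  rewrite (bigD1 a) -?bu //= eqxx big1 // => v /andP[_ va].
  by rewrite xpair_eqE [a == v]eq_sym (negPf va).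
Qed.

(* For a loopless graph all the rows are of sum zero, so this is the subgroup of
   [zero_sum_group] generated by them. *)
Definition row_span (G : multigraph) : pred (zero_sum_group (vertex G)) :=
  fun z => `[< exists a : vertex G -> int,
                 val z = \sum_u degree_row u *~ a u >].

Fact row_span_zmod_closed (G : multigraph) : zmod_closed (@row_span G).
Proof.
split=> [|x y]; rewrite !unfold_in.
  apply/asboolP; exists (fun=> 0); rewrite raddf0 big1 // => u /= _; exact: mulr0z.
move=> /asboolP[a xa] /asboolP[b yb]; apply/asboolP.
exists (fun u => a u - b u); rewrite raddfB /= xa yb -sumrB.
by apply: eq_bigr => u _; rewrite mulrzBr.
Qed.

HB.instance Definition _ (G : multigraph) :=
  GRing.isZmodClosed.Build (zero_sum_group (vertex G)) (@row_span G)
    (row_span_zmod_closed G).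

Definition degree_class_group (G : multigraph) : zmodType :=
  Quotient.quot (GRing.ZmodClosed.clone _ (@row_span G) _).

Definition cyclic_zmod (A : zmodType) : Prop :=
  exists g : A, forall x : A, exists m : int, x = g *~ m.

Definition generated_equiv (T : finType) (r : rel T) : rel T :=
  connect (fun x y => r x y || r y x).

Fact generated_equiv_is_equiv (T : finType) (r : rel T) :
  equiv_class_of (generated_equiv r).
Proof.
split; [exact: connect0 | | exact: connect_trans].
by apply: sym_connect_sym => x y; rewrite orbC.
Qed.

Canonical generated_equiv_equiv (T : finType) (r : rel T) :=
  EquivRelPack (generated_equiv_is_equiv r).
Canonical generated_equiv_encModRel (T : finType) (r : rel T) :=
  defaultEncModRel (generated_equiv r).

Definition identified (T : finType) (r : rel T) : Type :=
  {eq_quot generated_equiv r}.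

HB.instance Definition _ (T : finType) (r : rel T) :=
  EqQuotient.on (identified r).
HB.instance Definition _ (T : finType) (r : rel T) :=
  Finite.copy (identified r)
    (can_type (@EquivQuot.ereprK _ _ _ _ _ (generated_equiv_encModRel r))).

(* A graph with a distinguished cycle of length [k].  Indices start at 0, so the
   vertex v_i of the cycle is [mark_v] at the ordinal i - 1, and [mark_e] at the
   ordinal i - 1 is the edge v_i v_{i+1} (the edge v_k v_1 when i = k). *)
Record marked_graph (k : nat) := MarkedGraph {
  mark_graph : multigraph;
  mark_v : 'I_k -> vertex mark_graph;
  mark_e : 'I_k -> edge mark_graph }.

Definition cycle_graph (k : nat) : multigraph :=
  @Multigraph 'I_k 'I_k (fun i => (i, ordS i)).

Definition marked_cycle (k : nat) : marked_graph k :=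
  @MarkedGraph k (cycle_graph k) id id.

(* v'_1 ~ v_h and v'_{k'} ~ v_{h+1}, where v' runs over the new cycle. *)
Definition glue_v (k k' h : nat) (P : marked_graph k) :
    rel (vertex (mark_graph P) + 'I_k') :=
  fun x y => match x, y with
  | inl a, inr j => [exists i : 'I_k, (a == mark_v P i) &&
      (((i.+1 == h) && (j == 0 :> nat)) || ((i == h :> nat) && (j.+1 == k')))]
  | _, _ => false
  end.

(* v'_{k'} v'_1 ~ v_h v_{h+1}. *)
Definition glue_e (k k' h : nat) (P : marked_graph k) :
    rel (edge (mark_graph P) + 'I_k') :=
  fun x y => match x, y with
  | inl a, inr j => [exists i : 'I_k,
      [&& a == mark_e P i, i.+1 == h & j.+1 == k']]
  | _, _ => false
  end.

Arguments glue_v {k} k' h P _ _.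
Arguments glue_e {k} k' h P _ _.

Definition union_ends (k k' : nat) (P : marked_graph k)
    (e : edge (mark_graph P) + 'I_k') :
    (vertex (mark_graph P) + 'I_k') * (vertex (mark_graph P) + 'I_k') :=
  match e with
  | inl a => (inl (ends a).1, inl (ends a).2)
  | inr j => (inr j, inr (ordS j))
  end.

(* Two identified edges have the same unordered pair of ends up to [glue_v], so
   the choice of the representative [repr e] is immaterial. *)
Definition glued_graph (k k' h : nat) (P : marked_graph k) : multigraph :=
  @Multigraph (identified (glue_v k' h P)) (identified (glue_e k' h P))
    (fun e => (\pi_(identified (glue_v k' h P)) (union_ends (repr e)).1,
               \pi_(identified (glue_v k' h P)) (union_ends (repr e)).2)).

Definition glue_cycle (k k' h : nat) (P : marked_graph k) : marked_graph k' :=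
  @MarkedGraph k' (glued_graph k' h P)
    (fun j => \pi_(identified (glue_v k' h P)) (inr j))
    (fun j => \pi_(identified (glue_e k' h P)) (inr j)).

(* [polygon_chain k h m] is CS^{m+1}, with its last polygon marked, for the
   parameters k 0, ..., k m and h 0, ..., h m. *)
Fixpoint polygon_chain (k h : nat -> nat) (m : nat) : marked_graph (k m) :=
  match m with
  | 0 => marked_cycle (k 0%N)
  | m'.+1 => glue_cycle (k m'.+1) (h m') (polygon_chain k h m')
  end.

Definition CS (n : nat) (k h : n.-tuple nat) : multigraph :=
  mark_graph (polygon_chain (nth 0%N k) (nth 0%N h) n.-1).

(* Main.v *)
Require Import Defs.
From HB Require Import structures.
From mathcomp Require Import all_boot all_order all_algebra.
From mathcomp Require Import boolp ring.

(** In the degree class group, let f v be the class of v - o for a fixed vertex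
o. The rows of the Laplacian vanish in the quotient, so f is a harmonic function
on the graph, with values in the group, and those values generate the group.
It is enough to show that on a chain of polygons all the differences of a
harmonic function are multiples of one element g.

By planar duality a harmonic function on a plane graph is given by a potential
on the faces, whose difference across an edge is the difference of f along it.
Let phi_i be the potential on the i-th polygon, with potential 0 on the outer
face. A polygon borders only its two neighbours in the chain, along one edge
each, and the outer face, so that going round the i-th polygon gives
k_i phi_i = phi_{i-1} + phi_{i+1}. Hence every phi_i is a multiple of phi_1,
and the group is cyclic, generated by phi_1.

The proof below follows this recursion one polygon at a time, without dual
graphs. Harmonicity is used in weak form, through the Dirichlet pairing
  dirichlet t f = sum over the edges xy of (f y - f x) (t y - t x)
with integer test functions t. This expression does not depend on the
orientation of the edges and is additive under gluing ([dirichlet_glue]). The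
induction needs functions that fail to be harmonic at the two ends of an edge xy
of the last polygon, where the next polygon will exert a current phi:
dirichlet t f = phi (t y - t x) for all t. The property [rigid] says that in that
case all differences of f, and phi as well, are multiples of one g; the
harmonic case is phi = 0.

In the inductive step ([rigid_glue]), the new polygon is a path joining the ends
x and y of the glued edge. Testing against a function that jumps from t x to t y
at a single edge of that path shows that f increases by the same psi along each
edge of the path, except for an extra phi on the marked one ([path_values]), and
that the restriction of f to the old graph satisfies the hypothesis with current
- psi. By induction psi and f y - f x are multiples of g. As f y - f x is
(number of edges of the path) psi + phi, so is phi, and then so is every
difference of f on the path. The single cycle ([rigid_cycle]) is the same
computation with its closing edge in place of the old graph, and g = psi. *)

Set Implicit Arguments.
Unset Strict Implicit.
Unset Printing Implicit Defensive.

Import Order.TTheory GRing.Theory Num.Theory.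
Local Open Scope ring_scope.
Local Open Scope quotient_scope.

(** * Functions and sums on a type with identified points *)

Section Quotient.
Variables (T : finType) (r : rel T).

Lemma identified_eq (x y : T) :
  r x y -> \pi_(identified r) x = \pi_(identified r) y.
Proof.
move=> rxy; apply/eqP; rewrite eqmodE.
by apply: connect1; rewrite rxy.
Qed.

Lemma identified_invariant (X : Type) (F : T -> X) (x y : T) :
  (forall a b, r a b -> F a = F b) ->
  \pi_(identified r) x = \pi_(identified r) y -> F x = F y.
Proof.
move=> Fr /eqP; rewrite eqmodE => /connectP[s sP ->].
elim: s x sP => //= b s IH a /andP[/orP ab /IH <-].
by case: ab => /Fr.
Qed.

Lemma identified_repr (X : Type) (F : T -> X) (x : T) :
  (forall a b, r a b -> F a = F b) ->
  F (repr (\pi_(identified r) x)) = F x.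
Proof. by move=> Fr; apply: (identified_invariant Fr); rewrite reprK. Qed.

(** A map N that sends each point to a canonical representative of its class puts
the classes in bijection with the fixed points of N. *)
Lemma sum_identified (A : nmodType) (N : T -> T) (F : T -> A) :
  (forall a b, r a b -> N a = N b) ->
  (forall a, \pi_(identified r) (N a) = \pi_(identified r) a) ->
  (forall a b, r a b -> F a = F b) ->
  \sum_(e : identified r) F (repr e) = \sum_(x | N x == x) F x.
Proof.
move=> Nr piN Fr.
have NN x : N (N x) = N x by apply: (identified_invariant Nr).
rewrite (reindex_onto (fun e : identified r => N (repr e))
                      (fun x => \pi_(identified r) x)) /=; last first.
  by move=> x /eqP Nx; rewrite (identified_repr x Nr).
apply: eq_big => [e | e _]; first by rewrite NN piN reprK !eqxx.
by apply: (identified_invariant Fr); rewrite piN.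
Qed.

End Quotient.

(** * Multiples of an element, and functions along a path *)

Definition multiple (A : zmodType) (g x : A) : Prop := exists m : int, x = g *~ m.

Lemma multipleB (A : zmodType) (g x y : A) :
  multiple g x -> multiple g y -> multiple g (x - y).
Proof. by move=> [m ->] [n ->]; exists (m - n); rewrite mulrzBr. Qed.

Lemma multiple0 (A : zmodType) (g : A) : multiple g 0.
Proof. by exists 0; rewrite mulr0z. Qed.

Lemma multipleN (A : zmodType) (g x : A) : multiple g x -> multiple g (- x).
Proof. by move=> gx; rewrite -sub0r; apply: multipleB => //; exact: multiple0. Qed.

Lemma multipleD (A : zmodType) (g x y : A) :
  multiple g x -> multiple g y -> multiple g (x + y).
Proof. by move=> gx gy; rewrite -[y]opprK; apply/multipleB/multipleN. Qed.

Lemma multipleMz (A : zmodType) (g x : A) (m : int) :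
  multiple g x -> multiple g (x *~ m).
Proof. by move=> [n ->]; exists (n * m); rewrite mulrzA. Qed.

Lemma multiple_sum (A : zmodType) (g : A) (I : finType) (F : I -> A) :
  (forall i, multiple g (F i)) -> multiple g (\sum_i F i).
Proof.
by move=> gF; apply: big_ind => // [|x y]; [exact: multiple0 | exact: multipleD].
Qed.

(** The total increase u K - u 0 is psi *+ K + phi, because the exceptional step p
occurs exactly once; this expresses phi, and then every u i - u 0, through
multiples of g. *)
Lemma path_values (A : zmodType) (g psi phi : A) (K p : nat) (u : nat -> A) :
  (p < K)%N -> multiple g psi -> multiple g (u K - u 0%N) ->
  (forall i, (i < K)%N -> u i.+1 - u i = psi + phi *+ (i == p)) ->
  multiple g phi /\ forall i, (i <= K)%N -> multiple g (u i - u 0%N).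
Proof.
move=> pK gpsi guK du.
have uE i : (i <= K)%N -> u i - u 0%N = psi *+ i + phi *+ (p < i)%N.
  elim: i => [|i IH] iK; first by rewrite subrr addr0.
  rewrite -(subrKA (u i)) du // (IH (ltnW iK)) addrACA -mulrS -mulrnDr.
  congr (_ + _ *+ _); rewrite ltnS [(p <= i)%N]leq_eqVlt [p == i]eq_sym.
  by case: eqP => [->|]; rewrite ?ltnn.
have gphi : multiple g phi.
  have ->: phi = (u K - u 0%N) - psi *+ K by rewrite uE // pK addrC addKr.
  by apply: multipleB => //; rewrite pmulrn; apply: multipleMz.
split=> // i iK; rewrite uE // !pmulrn.
by apply: multipleD; apply: multipleMz.
Qed.

(** Pairing with a step function selects the edge at which it jumps. *)
Lemma sum_cut (A : zmodType) (K i : nat) (D : nat -> A) (a b : int) :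
  (i < K)%N ->
  \sum_(m < K) D m *~ ((if (m.+1 <= i)%N then a else b) -
                       (if (m <= i)%N then a else b)) = D i *~ (b - a).
Proof.
move=> iK; rewrite (bigD1 (Ordinal iK)) //= ltnn leqnn big1 ?addr0 // => m mi.
have {}mi : m != i :> nat by rewrite -val_eqE in mi.
by rewrite [(m <= i)%N]leq_eqVlt (negPf mi) /= subrr mulr0z.
Qed.

Lemma ordS_inord (K i : nat) : (i < K)%N -> ordS (inord i : 'I_K.+1) = inord i.+1.
Proof.
by move=> iK; apply: val_inj; rewrite /= !inordK ?modn_small // ltnS ltnW.
Qed.

Lemma inord_first (K : nat) : inord 0 = ord0 :> 'I_K.+1.
Proof. by apply: val_inj; rewrite /= inordK. Qed.

Lemma inord_last (K : nat) : inord K = ord_max :> 'I_K.+1.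
Proof. by apply: val_inj; rewrite /= inordK. Qed.

Lemma widen_ord_inord (K : nat) (i : 'I_K) : widen_ord (leqnSn K) i = inord i.
Proof. by apply: val_inj; rewrite /= inordK // ltnW // ltnS. Qed.

Lemma ordS_max (K : nat) : ordS (@ord_max K) = ord0.
Proof. by apply: val_inj; rewrite /= modnn. Qed.

(** * The Dirichlet pairing and rigid graphs *)

Definition edge_energy (V : Type) (A : zmodType) (t : V -> int) (f : V -> A)
    (x : V * V) : A :=
  (f x.2 - f x.1) *~ (t x.2 - t x.1).

Lemma edge_energyC (V : Type) (A : zmodType) (t : V -> int) (f : V -> A) (a b : V) :
  edge_energy t f (a, b) = edge_energy t f (b, a).
Proof. by rewrite /edge_energy /= -[RHS]opprK -mulrNz -mulNrz !opprB. Qed.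

Definition dirichlet (G : multigraph) (A : zmodType) (t : vertex G -> int)
    (f : vertex G -> A) : A :=
  \sum_(e : edge G) edge_energy t f (ends e).

(** A loop would break the relation between degrees and multiplicities, and if a
marked edge did not join consecutive marked vertices then the two edges that a
gluing identifies could contribute differently to [dirichlet]. *)
Record well_marked (k : nat) (P : marked_graph k) : Prop := WellMarked {
  well_marked_loopless : loopless (mark_graph P);
  well_marked_joins : forall i, joins (mark_e P i) (mark_v P i) (mark_v P (ordS i)) }.

(** The weak form of: the Laplacian of f is concentrated at the ends of the marked
edge p, with opposite values phi and - phi. The last marked edge, with
p.+1 = k, is excluded: it is the one along which the polygon was attached. *)
Definition rigid (k : nat) (P : marked_graph k) : Prop :=
  forall (A : zmodType) (f : vertex (mark_graph P) -> A) (phi : A) (p : 'I_k),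
    (p.+1 < k)%N ->
    (forall t, dirichlet t f = phi *~ (t (mark_v P (ordS p)) - t (mark_v P p))) ->
    exists g, (forall x y, multiple g (f x - f y)) /\ multiple g phi.

Lemma mark_v_neq (k : nat) (P : marked_graph k) :
  well_marked P -> forall i, mark_v P i != mark_v P (ordS i).
Proof.
move=> [lP jP] i; have := lP (mark_e P i).
by case/orP: (jP i) => /eqP -> //=; rewrite eq_sym.
Qed.

Definition path_energy (K : nat) (A : zmodType) (t : 'I_K.+1 -> int)
    (f : 'I_K.+1 -> A) : A :=
  \sum_(i < K) edge_energy t f (inord i, inord i.+1).

Lemma path_energy_cut (K : nat) (A : zmodType) (f : 'I_K.+1 -> A) (t : 'I_K.+1 -> int)
    (a b : int) (i : nat) :
  (i < K)%N ->
  (forall m, (m <= K)%N -> t (inord m) = if (m <= i)%N then a else b) ->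
  path_energy t f = (f (inord i.+1) - f (inord i)) *~ (b - a).
Proof.
move=> iK tE; rewrite -(sum_cut (fun i => f (inord i.+1) - f (inord i)) _ _ iK).
by apply: eq_bigr => m _; rewrite /edge_energy /= !tE // ltnW.
Qed.

(** * Gluing a cycle along a marked edge *)

Section Gluing.
Variables (k K : nat) (P : marked_graph k) (p : 'I_k).
Hypotheses (K_gt0 : (0 < K)%N) (p_lt : (p.+1 < k)%N).
Hypothesis wmP : well_marked P.

Let P' := glue_cycle K.+1 p.+1 P.
Let piv (x : vertex (mark_graph P) + 'I_K.+1) : vertex (mark_graph P') :=
  \pi_(identified (glue_v K.+1 p.+1 P)) x.
Let pie (x : edge (mark_graph P) + 'I_K.+1) : edge (mark_graph P') :=
  \pi_(identified (glue_e K.+1 p.+1 P)) x.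

Lemma glue_v_first : piv (inl (mark_v P p)) = piv (inr ord0).
Proof. by apply: identified_eq; apply/existsP; exists p; rewrite !eqxx. Qed.

Lemma glue_v_last : piv (inl (mark_v P (ordS p))) = piv (inr ord_max).
Proof.
apply: identified_eq; apply/existsP; exists (ordS p).
by rewrite /= modn_small // !eqxx orbT.
Qed.

(** The two glued pairs of vertices are the only compatibility conditions. *)
Lemma glued_extension (X : Type) (t : vertex (mark_graph P) -> X) (s : 'I_K.+1 -> X) :
  s ord0 = t (mark_v P p) -> s ord_max = t (mark_v P (ordS p)) ->
  exists t' : vertex (mark_graph P') -> X,
    (forall a, t' (piv (inl a)) = t a) /\ (forall j, t' (piv (inr j)) = s j).
Proof.
move=> s0 sK; pose F x := match x with inl a => t a | inr j => s j end.
have Fr x y : glue_v K.+1 p.+1 P x y -> F x = F y.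
  case: x y => [a|//] [//|j] /existsP[i /andP[/eqP -> /orP[]/andP[ip jj]]] /=.
    have ->: i = p by apply: val_inj; apply/eqP.
    by have ->: j = ord0 by apply: val_inj; apply/eqP.
  have ->: i = ordS p by apply: val_inj; rewrite /= modn_small //; apply/eqP.
  by have ->: j = ord_max by apply: val_inj; apply/eqP.
by exists (fun x => F (repr x)); split=> [a|j]; rewrite (identified_repr _ Fr).
Qed.

(** The closing edge of the new cycle is represented by the old edge it is glued
to, so that the edges of the glued graph are the old ones together with the edges
of the path from the vertex [ord0] to the vertex [ord_max] of the new cycle. *)
Definition fold_edge (x : edge (mark_graph P) + 'I_K.+1) :=
  if x is inr j then if j == ord_max then inl (mark_e P p) else x else x.

Lemma glue_e_fold x y : glue_e K.+1 p.+1 P x y -> fold_edge x = fold_edge y.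
Proof.
case: x y => [a|//] [//|j] /existsP[i /and3P[/eqP -> ip jj]] /=.
have ->: i = p by apply: val_inj; apply/eqP.
have ->: j = ord_max by apply: val_inj; apply/eqP.
by rewrite eqxx.
Qed.

Lemma pie_fold x : pie (fold_edge x) = pie x.
Proof.
case: x => //= j; case: eqP => // ->.
by apply: identified_eq; apply/existsP; exists p; rewrite /= !eqxx.
Qed.

Definition union_piv (x : edge (mark_graph P) + 'I_K.+1) :=
  (piv (union_ends x).1, piv (union_ends x).2).

Lemma joins_inl (a : edge (mark_graph P)) x y : joins a x y ->
  union_piv (inl a) = (piv (inl x), piv (inl y)) \/
  union_piv (inl a) = (piv (inl y), piv (inl x)).
Proof. by case/orP => /eqP; rewrite /union_piv /= => ->; [left | right]. Qed.

(** The two edges that are glued may have been oriented in opposite directions,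
whence the second case. *)
Lemma union_piv_fold x : union_piv (fold_edge x) = union_piv x \/
  union_piv (fold_edge x) = ((union_piv x).2, (union_piv x).1).
Proof.
case: x => [a|j] /=; first by left.
case: eqP => [->|_]; last by left.
case: (joins_inl (well_marked_joins wmP p)) => ->; rewrite glue_v_first glue_v_last.
  by right; rewrite /union_piv /= ordS_max.
by left; rewrite /union_piv /= ordS_max.
Qed.

Lemma glued_edge_ind (Q : vertex (mark_graph P') * vertex (mark_graph P') -> Prop) :
  (forall x y, Q (x, y) -> Q (y, x)) ->
  (forall a : edge (mark_graph P), Q (piv (inl (ends a).1), piv (inl (ends a).2))) ->
  (forall i, (i < K)%N -> Q (piv (inr (inord i)), piv (inr (inord i.+1)))) ->
  forall x, Q (union_piv x).
Proof.
move=> Qsym Ql Qr x.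
suff Qf: Q (union_piv (fold_edge x)).
  by case: (union_piv_fold x) Qf => -> //= /Qsym.
case: x => [a|j] /=; first exact: Ql.
case: eqP => [_|/eqP jK]; first exact: Ql.
have {}jK : (j < K)%N by rewrite ltn_neqAle jK -ltnS ltn_ord.
by rewrite /union_piv /= -[j]inord_val ordS_inord //; apply: Qr.
Qed.

(** The edge shared by the old graph and the new cycle is counted once, in the
first summand. *)
Lemma dirichlet_glue (A : zmodType) (t : vertex (mark_graph P') -> int)
    (f : vertex (mark_graph P') -> A) :
  dirichlet t f =
    dirichlet (fun a => t (piv (inl a))) (fun a => f (piv (inl a))) +
    path_energy (fun j => t (piv (inr j))) (fun j => f (piv (inr j))).
Proof.
pose F x := edge_energy t f (union_piv x).
have FN x : F (fold_edge x) = F x.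
  by rewrite /F; case: (union_piv_fold x) => ->; rewrite // edge_energyC; case: union_piv.
have Fr x y : glue_e K.+1 p.+1 P x y -> F x = F y.
  by move=> /glue_e_fold xy; rewrite -FN xy FN.
rewrite [LHS](sum_identified glue_e_fold pie_fold Fr) big_sumType /=; congr (_ + _).
  by apply: eq_bigl => a; rewrite eqxx.
rewrite big_mkcond big_ord_recr /= eqxx /= addr0; apply: eq_bigr => i _.
have iK : (i < K)%N by [].
rewrite widen_ord_inord; have /negPf -> : inord i != ord_max :> 'I_K.+1.
  by rewrite -val_eqE /= inordK ?neq_ltn ?iK // ltnW.
by rewrite eqxx /F /union_piv /= ordS_inord.
Qed.

(** These are the test functions of the proof: constant on either side of the
edge i of the new path, they make [path_energy] see that edge alone. *)
Lemma cut_extension (X : Type) (t : vertex (mark_graph P) -> X) (i : nat) :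
  (i < K)%N ->
  exists t' : vertex (mark_graph P') -> X,
    (forall a, t' (piv (inl a)) = t a) /\
    (forall m, (m <= K)%N ->
       t' (piv (inr (inord m))) =
         if (m <= i)%N then t (mark_v P p) else t (mark_v P (ordS p))).
Proof.
move=> iK; pose s (j : 'I_K.+1) :=
  if (j <= i)%N then t (mark_v P p) else t (mark_v P (ordS p)).
have [||t' [tl tr]] := @glued_extension X t s; rewrite /s ?leq0n //=.
  by rewrite leqNgt iK.
by exists t'; split=> // m mK; rewrite tr /s inordK.
Qed.

Lemma well_marked_glue : well_marked P'.
Proof.
have lP := well_marked_loopless wmP.
split=> [e|j].
  (* The ends of an edge are told apart by mapping the glued graph back to the old
     one, collapsing the whole new path except for one edge. *)
  apply: (@glued_edge_ind (fun x => x.1 != x.2)) => [x y|a|i iK] /=.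
  - by rewrite eq_sym.
  - have [t [tl _]] := cut_extension id K_gt0.
    by apply/eqP => /(congr1 t); rewrite !tl; apply/eqP/lP.
  - have [t [_ tr]] := cut_extension id iK.
    apply/eqP => /(congr1 t); rewrite !tr ?(ltnW iK) //= leqnn ltnn.
    have := lP (mark_e P p).
    by case/orP: (well_marked_joins wmP p) => /eqP -> /eqP // ab /esym.
(* Joining two given vertices is invariant under swapping the ends of an edge,
   so it can be read off from any representative. *)
pose F x := (union_piv x == (mark_v P' j, mark_v P' (ordS j))) ||
            (union_piv x == (mark_v P' (ordS j), mark_v P' j)).
have FN x : F (fold_edge x) = F x.
  rewrite /F; case: (union_piv_fold x) => -> //.
  by case: (union_piv x) => a b; rewrite !xpair_eqE orbC andbC [X in _ || X]andbC.
have Fr x y : glue_e K.+1 p.+1 P x y -> F x = F y.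
  by move=> /glue_e_fold xy; rewrite -FN xy FN.
change (F (repr (pie (inr j)))); rewrite (identified_repr _ Fr).
by apply/orP; left.
Qed.

(** Cutting the new path at its edge i expresses the pairing of t with f on the
old graph through the increase of f along that edge. The left-hand side being
independent of i, the increase is a constant psi, corrected by phi at p'; and
the old graph carries the current - psi along the glued edge. *)
Lemma rigid_glue : rigid P -> rigid P'.
Proof.
move=> rigP A f phi p'; rewrite ltnS => p'K fE.
pose u i := f (mark_v P' (inord i)).
have vp' : mark_v P' p' = piv (inr (inord p')) by rewrite inord_val.
have vSp' : mark_v P' (ordS p') = piv (inr (inord p'.+1)).
  by rewrite -[p' in LHS]inord_val ordS_inord.
have du i : (i < K)%N -> forall t,
    dirichlet t (fun a => f (piv (inl a))) =
      (phi *+ (i == p') - (u i.+1 - u i)) *~ (t (mark_v P (ordS p)) - t (mark_v P p)).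
  move=> iK t; have [t' [tl tr]] := cut_extension t iK.
  have := fE t'; rewrite dirichlet_glue (path_energy_cut _ iK tr).
  have -> : dirichlet (fun a => t' (piv (inl a))) (fun a => f (piv (inl a))) =
            dirichlet t (fun a => f (piv (inl a))).
    by apply: eq_bigr => e _; rewrite /edge_energy !tl.
  rewrite vp' vSp' (tr _ p'K) (tr _ (ltnW p'K)) => /(canRL (addrK _)) ->.
  rewrite [RHS]mulrzBl; congr (_ - _).
  have [->|ip] := eqVneq i p'; first by rewrite leqnn ltnn.
  by rewrite mul0rz [(p' <= i)%N]leq_eqVlt eq_sym (negPf ip) /= subrr mulr0z.
(* Any t with t (mark_v P (ordS p)) - t (mark_v P p) = 1 determines psi. *)
pose t0 a : int := (a == mark_v P (ordS p))%:Z.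
pose psi := - dirichlet t0 (fun a => f (piv (inl a))).
have upsi i : (i < K)%N -> u i.+1 - u i = psi + phi *+ (i == p').
  move=> iK; rewrite /psi (du i iK) /t0 eqxx (negPf (mark_v_neq wmP p)) subr0 mulr1z.
  by rewrite opprD opprK addrAC addNr add0r.
have [|g [gP gpsi]] := rigP A (fun a => f (piv (inl a))) (- psi) p p_lt.
  move=> t; rewrite (du p' p'K) (upsi p' p'K) eqxx.
  by rewrite opprD addrCA subrr addr0.
have {}gpsi : multiple g psi by rewrite -[psi]opprK; apply: multipleN.
have u0 : u 0%N = f (piv (inl (mark_v P p))) by rewrite /u inord_first glue_v_first.
have guK : multiple g (u K - u 0%N).
  have -> : u K = f (piv (inl (mark_v P (ordS p)))) by rewrite /u inord_last glue_v_last.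
  by rewrite u0; apply: gP.
have [gphi gu] := path_values p'K gpsi guK upsi.
exists g; split=> //.
have gx x : multiple g (f x - u 0%N).
  rewrite -[x]reprK; case: (repr x) => [a|j]; last first.
    by rewrite -[j]inord_val; apply: gu; rewrite -ltnS.
  by rewrite u0; apply: gP.
by move=> x y; rewrite -(subrKA (u 0%N)) -[u 0%N - _]opprB; apply: multipleB.
Qed.

End Gluing.

(** * Chains of polygons *)

Lemma well_marked_cycle (K : nat) : (0 < K)%N -> well_marked (marked_cycle K.+1).
Proof.
move=> K_gt0; split=> [e|i]; last by rewrite /joins eqxx.
rewrite /= -val_eqE /=.
have := ltn_ord e; rewrite ltnS leq_eqVlt => /orP[/eqP ->|eK].
  by rewrite modnn -lt0n.
by rewrite modn_small // neq_ltn leqnn.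
Qed.

(** A cycle is a path from [ord0] to [ord_max] closed by one edge, and the closing
edge determines psi = f ord0 - f ord_max, which serves as g. *)
Lemma rigid_cycle (K : nat) : (0 < K)%N -> rigid (marked_cycle K.+1).
Proof.
move=> K_gt0 A f phi p; rewrite ltnS => pK fE.
pose u i := f (inord i : 'I_K.+1).
have f0 : f ord0 = u 0%N by rewrite /u inord_first.
have fK : f ord_max = u K by rewrite /u inord_last.
have dE t : dirichlet t f = path_energy t f + edge_energy t f (ord_max, ord0).
  rewrite /dirichlet big_ord_recr /= ordS_max; congr (_ + _); apply: eq_bigr => i _.
  by rewrite widen_ord_inord ordS_inord.
have du i : (i < K)%N -> u i.+1 - u i = (u 0%N - u K) + phi *+ (i == p).
  move=> iK; pose t (j : 'I_K.+1) : int := if (j <= i)%N then 0 else 1.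
  have tE m : (m <= K)%N -> t (inord m) = if (m <= i)%N then 0 else 1.
    by move=> mK; rewrite /t inordK.
  have := fE t; rewrite dE (path_energy_cut _ iK tE) /edge_energy /= f0 fK.
  rewrite -[p in RHS]inord_val ordS_inord // !tE ?(ltnW pK) //.
  rewrite /t /= leqNgt iK /= subr0 sub0r mulrN1z mulr1z opprB.
  move=> /(canRL (addrK _)) ->.
  rewrite opprB addrC; congr (_ + _).
  have [->|ip] := eqVneq i p; first by rewrite leqnn ltnn.
  by rewrite [(p <= i)%N]leq_eqVlt eq_sym (negPf ip) /= subrr mulr0z.
pose g := u 0%N - u K.
have gg : multiple g g by exists 1.
have guK : multiple g (u K - u 0%N) by rewrite -opprB; apply: multipleN.
have [gphi gu] := path_values pK gg guK du.
exists g; split=> // x y; rewrite -(subrKA (u 0%N)) -[u 0%N - _]opprB.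
by apply: multipleB; [rewrite -[x]inord_val | rewrite -[y]inord_val];
   apply: gu; rewrite -ltnS.
Qed.

Lemma polygon_chain_rigid (k h : nat -> nat) (m : nat) :
  (forall i, (i <= m)%N -> (1 < k i)%N) ->
  (forall i, (i <= m)%N -> (0 < h i < k i)%N) ->
  well_marked (polygon_chain k h m) /\ rigid (polygon_chain k h m).
Proof.
elim: m => [|m IH] k1 hk /=.
  have := k1 0%N isT; case: (k 0%N) => [|[|K]] // _.
  by split; [exact: well_marked_cycle | exact: rigid_cycle].
have [|| wm rig] := IH; first by move=> i im; apply/k1/ltnW.
  by move=> i im; apply/hk/ltnW.
have := k1 m.+1 (leqnn _); case: (k m.+1) => [|[|K]] // _.
have := hk m (leqnSn _); case: (h m) => [|p] //= pk.
pose p' := Ordinal (ltnW pk).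
by split; [exact: (@well_marked_glue _ _ _ p') | exact: (@rigid_glue _ _ _ p')].
Qed.

(** * Vertices in the degree class group *)

Section DegreeClassGroup.
Variables (G : multigraph) (loopG : loopless G).

Definition incidence (e : edge G) (v : vertex G) : int :=
  (v == (ends e).2)%:Z - (v == (ends e).1)%:Z.

Lemma card_setE (T : finType) (Q : pred T) : #|[set x | Q x]|%:Z = \sum_x (Q x)%:Z.
Proof.
rewrite -sum1dep_card big_mkcond /= (big_morph Posz PoszD (erefl _)).
by apply: eq_bigr => x _; case: (Q x).
Qed.

(** The Laplacian is the incidence matrix times its transpose; an edge contributes
to the diagonal entry exactly once for each of its ends, as they are distinct. *)
Lemma degree_row_incidence u v :
  degree_row u v = - \sum_e incidence e u * incidence e v.
Proof.
rewrite ffunE; have [->|vu] := eqVneq v u.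
  congr (- _); rewrite /degree PoszD !card_setE -big_split /=; apply: eq_bigr => e _.
  rewrite /incidence ![u == _]eq_sym; have := loopG e; case: (ends e) => a b /=.
  by case: (eqVneq a u) => [->|_]; case: (eqVneq b u).
rewrite /multiplicity card_setE -sumrN; apply: eq_bigr => e _.
rewrite /incidence /joins; case: (ends e) => a b /=; rewrite !xpair_eqE.
rewrite ![u == _]eq_sym ![v == _]eq_sym.
have [->|_] := eqVneq a u; have [->|_] := eqVneq b u;
  rewrite ?[u == v]eq_sym ?(negPf vu) ?andbF //=;
  by case: (a == v); case: (b == v).
Qed.

Lemma incidence_gradient (t : vertex G -> int) v :
  \sum_e incidence e v * (t (ends e).2 - t (ends e).1) =
  - \sum_u t u * degree_row u v.
Proof.
have sum_ind w : t w = \sum_u t u * (u == w)%:Z.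
  rewrite (bigD1 w) //= eqxx mulr1 big1 ?addr0 // => u /negPf ->.
  by rewrite mulr0.
rewrite -sumrN; under [RHS]eq_bigr => u _ do
  rewrite degree_row_incidence mulrN opprK mulr_sumr.
rewrite exchange_big; apply: eq_bigr => e _ /=.
rewrite (sum_ind (ends e).2) (sum_ind (ends e).1) -sumrB mulr_sumr.
by apply: eq_bigr => u _; rewrite /incidence; ring.
Qed.

Lemma vertex_diff_zero_sum (o v : vertex G) :
  [ffun x => (x == v)%:Z - (x == o)%:Z] \in @zero_sum (vertex G).
Proof.
rewrite unfold_in; under eq_bigr do rewrite ffunE.
rewrite sumrB subr_eq0; apply/eqP.
have sum1 w : \sum_(x : vertex G) (x == w)%:Z = 1.
  by rewrite (bigD1 w) //= eqxx big1 ?addr0 // => x /negPf ->.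
by rewrite !sum1.
Qed.

Definition vertex_diff (o v : vertex G) : zero_sum_group (vertex G) :=
  ZeroSum (vertex_diff_zero_sum o v).

Definition dcg_pi (z : zero_sum_group (vertex G)) : degree_class_group G :=
  \pi_(Quotient.quot (GRing.ZmodClosed.clone _ (@row_span G) _)) z.

Lemma dcg_pi_zmod_morphism : zmod_morphism dcg_pi.
Proof. move=> x y; exact: raddfB. Qed.

HB.instance Definition _ := GRing.isZmodMorphism.Build
  (zero_sum_group (vertex G)) (degree_class_group G) dcg_pi dcg_pi_zmod_morphism.

Lemma dcg_pi_surj (x : degree_class_group G) : exists z, x = dcg_pi z.
Proof.
exists (repr (x : Quotient.quot (GRing.ZmodClosed.clone _ (@row_span G) _))).
by rewrite /dcg_pi reprK.
Qed.

Lemma dcg_pi_eq0 z : z \in @row_span G -> dcg_pi z = 0.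
Proof.
move=> zG; rewrite -[RHS](raddf0 dcg_pi); apply/eqP.
by rewrite /dcg_pi -Quotient.idealrBE subr0.
Qed.

Lemma ffunMzE (I : finType) (A : zmodType) (f : {ffun I -> A}) (m : int) x :
  (f *~ m) x = f x *~ m.
Proof. by case: m => m; rewrite ?NegzE ?mulrNz -!pmulrn ?ffunE ffunMnE. Qed.

Lemma zs_val_sum (V I : finType) (x : I -> zero_sum_group V) (c : I -> int) v :
  val (\sum_i x i *~ c i) v = \sum_i val (x i) v * c i.
Proof.
rewrite raddf_sum sum_ffunE; apply: eq_bigr => i _; rewrite raddfMz -mulrzz.
exact: ffunMzE.
Qed.

Lemma zs_valB (V : finType) (x y : zero_sum_group V) v :
  val (x - y) v = val x v - val y v.
Proof. by rewrite raddfB !ffunE. Qed.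

(** The map sending v to the class of v - o is harmonic: its pairing with t is,
up to sign, the combination of the rows with coefficients t. *)
Lemma dirichlet_vertex_diff (o : vertex G) (t : vertex G -> int) :
  dirichlet t (fun v => dcg_pi (vertex_diff o v)) = 0.
Proof.
rewrite /dirichlet /edge_energy /=.
under eq_bigr => e _ do rewrite -raddfB -raddfMz.
rewrite -raddf_sum; apply: dcg_pi_eq0; rewrite unfold_in; apply/asboolP.
exists (fun u => - t u); apply/ffunP => v; rewrite zs_val_sum sum_ffunE.
under eq_bigr => e _ do rewrite zs_valB !ffunE opprB addrA subrK.
under [RHS]eq_bigr => u _ do rewrite ffunMzE mulrzz mulrN mulrC.
by rewrite sumrN -incidence_gradient.
Qed.

(** The elements v - o generate the group of zero-sum functions, as
z = sum_v z v (v - o) when the z v add up to 0. *)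
Lemma cyclic_of_vertex_diffs (o : vertex G) (g : degree_class_group G) :
  (forall v, multiple g (dcg_pi (vertex_diff o v))) ->
  cyclic_zmod (degree_class_group G).
Proof.
move=> gv; exists g => x; have [z ->] := dcg_pi_surj x.
have -> : z = \sum_v vertex_diff o v *~ val z v.
  apply: val_inj; apply/ffunP => w; rewrite zs_val_sum.
  under eq_bigr => v _ do rewrite ffunE mulrBl.
  rewrite sumrB -mulr_sumr (eqP (valP z : \sum_v val z v == 0)) mulr0 subr0.
  rewrite (bigD1 w) //= eqxx mul1r big1 ?addr0 // => v.
  by rewrite eq_sym => /negPf ->; rewrite mul0r.
rewrite raddf_sum; apply: multiple_sum => v; rewrite raddfMz; exact: multipleMz.
Qed.

End DegreeClassGroup.

Local Close Scope quotient_scope.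
Local Close Scope ring_scope.

Theorem theorem2p6 (n : nat) (k h : n.-tuple nat) :
  0 < n ->
  (forall i : 'I_n, 1 < tnth k i) ->
  (forall i : 'I_n, 0 < tnth h i < tnth k i) ->
  cyclic_zmod (degree_class_group (CS k h)).
Proof.
move=> n_gt0 k1 hk.
have k1' i : (i <= n.-1)%N -> (1 < nth 0 k i)%N.
  rewrite -ltnS prednK // => ni.
  by have := k1 (Ordinal ni); rewrite (tnth_nth 0%N).
have hk' i : (i <= n.-1)%N -> (0 < nth 0 h i < nth 0 k i)%N.
  rewrite -ltnS prednK // => ni.
  by have := hk (Ordinal ni); rewrite !(tnth_nth 0%N).
have [wm rig] := polygon_chain_rigid k1' hk'.
have loopG : loopless (CS k h) := well_marked_loopless wm.
have kn := k1' _ (leqnn _).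
(* The current is zero, so any marked edge p other than the last one will do. *)
pose p : 'I_(nth 0%N k n.-1) := Ordinal (ltnW kn).
pose o : vertex (CS k h) := mark_v (polygon_chain _ _ _) p.
have [|g [gf _]] := rig _ (fun v => dcg_pi (vertex_diff o v)) 0%R p kn.
  by move=> t; rewrite mul0rz; apply: dirichlet_vertex_diff.
apply: (@cyclic_of_vertex_diffs _ o g) => v.
have := gf v o; rewrite -raddfB; congr (multiple _ (dcg_pi _)).
by apply: val_inj; apply/ffunP => w; rewrite zs_valB !ffunE opprB addrA subrK.
Qed.
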